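(* Let $G$ be a finite solvable group and $X$ a set. Let $GAS(G)$ be a connected graph and suppose that $G$ has only one simple subgroup. If $GAS(G)$ has a pendant vertex, then $gas(G)=GAS(G)$.
   Context: For an action $\phi:G\times X\to X$ of $G$ on $X$, $G_x^{\phi}=\{g\in G:\phi(g,x)=x\}$ is the stabilizer of $x\in X$, and $e$ is the identity of $G$. The group action-stabilizer graph $GAS(G)$ (of $G$ on $X$) has as vertices the group actions of $G$ on $X$, and two distinct vertices $\phi,\psi$ are adjacent if and only if $\left(\bigcap_{x\in X}G_x^{\phi}\right)\cap\left(\bigcap_{x\in X}G_x^{\psi}\right)\neq\{e\}$; actions $\phi$ with $\bigcap_{x\in X}G_x^{\phi}=\{e\}$ (which would be isolated vertices) are removed from the vertex set. The graph $gas(G)$ is the (induced) subgraph of $GAS(G)$ obtained by keeping exactly one action $\phi$ for each distinct subgroup occurring as $\bigcap_{x\in X}G_x^{\phi}$. A pendant vertex is a vertex of degree one. *)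

(* Defs.v *)
From Stdlib Require Export Relation_Operators.
From mathcomp Require Export all_boot all_fingroup all_solvable.
From mathcomp Require Export boolp classical_sets functions cardinality.

Set Implicit Arguments.
Unset Strict Implicit.
Unset Printing Implicit Defensive.

Local Open Scope classical_set_scope.

(* A simple, possibly infinite, graph whose vertices are elements of a fixed
   ambient type, so that a subgraph and the whole graph have the same type and
   can be compared with [=]. *)
Record graph (T : Type) := Graph {
  vertices : set T;
  adj : T -> T -> Prop;
  adj_vertices : forall u v, adj u v -> vertices u /\ vertices v;
  adj_sym : forall u v, adj u v -> adj v u;
  adj_irrefl : forall u, ~ adj u u }.

Section Graphs.
Variable T : Type.
Implicit Type Gr : graph T.

Lemma graph_ext Gr Gr' :
  vertices Gr = vertices Gr' -> adj Gr = adj Gr' -> Gr = Gr'.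
Proof.
case: Gr Gr' => [V E p1 p2 p3] [V' E' q1 q2 q3] /= eV eE.
by subst V' E'; congr Graph; exact: Prop_irrelevance.
Qed.

Definition connected_graph Gr : Prop :=
  forall u v, vertices Gr u -> vertices Gr v -> clos_refl_trans _ (adj Gr) u v.

Definition has_degree Gr (v : T) (n : nat) : Prop :=
  ([set w | adj Gr v w] #= `I_n)%card.

Definition pendant_vertex Gr (v : T) : Prop :=
  vertices Gr v /\ has_degree Gr v 1.

Section Induced.
Variables (Gr : graph T) (Y : set T).

Let V : set T := vertices Gr `&` Y.
Let E u v : Prop := [/\ Y u, Y v & adj Gr u v].

Fact induced_adj_vertices u v : E u v -> V u /\ V v.
Proof. by case=> Yu Yv e; have [Vu Vv] := adj_vertices e. Qed.

Fact induced_adj_sym u v : E u v -> E v u.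
Proof. by case=> Yu Yv e; split=> //; exact: adj_sym. Qed.

Fact induced_adj_irrefl u : ~ E u u.
Proof. by case=> _ _; exact: adj_irrefl. Qed.

Definition induced : graph T :=
  Graph induced_adj_vertices induced_adj_sym induced_adj_irrefl.

End Induced.
End Graphs.

Section GroupActionStabilizerGraph.
(* The group is the whole finite group type [gT], so that distinct terms of type
   [{action gT &-> X}] are distinct actions: an [action G X] for a proper
   subgroup [G] of [gT] also carries irrelevant values outside of [G].
   MathComp actions are right actions; a left action [phi] corresponds to
   [to x g := phi (g^-1, x)], which has the same stabilizers. *)
Variables (gT : finGroupType) (X : Type).
Implicit Types phi psi : {action gT &-> X}.

(* Not [astab], which requires [X] to be finite. *)
Definition stab phi (x : X) : set gT := [set g | phi x g = x].

Definition action_ker phi : set gT := \bigcap_(x in [set: X]) stab phi x.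

Let V : set {action gT &-> X} := [set phi | action_ker phi <> [set 1%g]].
Let E phi psi : Prop :=
  [/\ V phi, V psi, phi <> psi &
      action_ker phi `&` action_ker psi <> [set 1%g]].

Fact GAS_adj_vertices phi psi : E phi psi -> V phi /\ V psi.
Proof. by case. Qed.

Fact GAS_adj_sym phi psi : E phi psi -> E psi phi.
Proof. by case=> Vphi Vpsi /nesym neq; rewrite setIC. Qed.

Fact GAS_adj_irrefl phi : ~ E phi phi.
Proof. by case. Qed.

Definition GAS : graph {action gT &-> X} :=
  Graph GAS_adj_vertices GAS_adj_sym GAS_adj_irrefl.

Definition ker_representatives (Y : set {action gT &-> X}) : Prop :=
  Y `<=` vertices GAS /\
  (forall phi, vertices GAS phi ->
     exists! psi, Y psi /\ action_ker psi = action_ker phi).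

(* [gas] depends on the choice of the representatives: [is_gas Gr] says that
   [Gr] is the graph obtained from one such choice. *)
Definition is_gas (Gr : graph {action gT &-> X}) : Prop :=
  exists2 Y, ker_representatives Y & Gr = induced GAS Y.

Lemma is_gas_exists : exists Gr, is_gas Gr.
Proof.
pose c (K : set gT) : option {action gT &-> X} :=
  if pselect (exists phi, action_ker phi = K) is left h
  then Some (projT1 (cid h)) else None.
have cP phi : exists2 psi, c (action_ker phi) = Some psi &
    action_ker psi = action_ker phi.
  rewrite /c; case: pselect => [h|[]]; last by exists phi.
  by exists (projT1 (cid h)) => //; exact: projT2 (cid h).
exists (induced GAS [set phi | V phi /\ c (action_ker phi) = Some phi]).
eexists; last by [].
split=> [phi []//|phi Vphi]; have [psi cpsi kpsi] := cP phi.
exists psi; split=> [|psi' [[_ +] kpsi']].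
  by split=> //; split; rewrite /V /= kpsi.
by rewrite kpsi' cpsi => -[].
Qed.

End GroupActionStabilizerGraph.

(* Main.v *)
Require Import Defs.

Set Implicit Arguments.
Unset Strict Implicit.
Unset Printing Implicit Defensive.

(** The unique simple subgroup is contained in every nontrivial subgroup, so any
    two nontrivial kernels meet nontrivially and [GAS] is a complete graph.
    A pendant vertex then leaves exactly two vertices. The trivial action is one
    of them and is the only action with kernel the whole group, so the two
    vertices have distinct kernels and every choice of representatives contains
    both. *)

(** By finiteness [K] contains a minimal nontrivial subgroup, which has no proper nontrivial
    subgroup at all, normal or not. *)
Lemma exists_simple_subgroup (gT : finGroupType) (K : {group gT}) :
  K :!=: 1%g -> exists2 H : {group gT}, simple H & H \subset K.
Proof.
move=> ntK; pose P (M : {set gT}) := M != 1%g.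
have [M /mingroupP[ntM minM] sMK] := @mingroup_exists _ P K ntK.
exists M => //; apply/mingroupP; split=> [|L /andP[ntL _] sLM].
  by rewrite [_ != _]ntM normG.
exact: minM.
Qed.

Section Kernels.
Variables (gT : finGroupType) (X : Type).
Implicit Types phi psi : {action gT &-> X}.

Lemma action_kerP phi g : action_ker phi g <-> forall x, phi x g = x.
Proof. by split=> [kg x|kg x _]; [exact: kg | exact: kg]. Qed.

(* The library's [actMin] and [act1] require [X] to be finite. *)
Lemma total_actM phi x g h : phi x (g * h)%g = phi (phi x g) h.
Proof. by case: phi => to [_ toM] /=; rewrite toM ?inE. Qed.

Lemma total_act1 phi x : phi x 1%g = x.
Proof.
(* Acting by 1 is idempotent and injective, hence the identity. *)
have /= := total_actM phi x 1%g 1%g; rewrite mulg1.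
by case: phi => to [to_inj _] /= /to_inj/esym.
Qed.

Lemma action_ker1 phi : action_ker phi 1%g.
Proof. by apply/action_kerP => x; exact: total_act1. Qed.

Lemma action_kerM phi g h :
  action_ker phi g -> action_ker phi h -> action_ker phi (g * h)%g.
Proof.
move=> /action_kerP kg /action_kerP kh; apply/action_kerP => x.
by rewrite total_actM kg kh.
Qed.

(** A kernel is a classical set, not a [{group gT}]; this transfers subgroups of [<[g]>] into it. *)
Lemma cycle_sub_action_ker phi g h :
  action_ker phi g -> h \in <[g]>%g -> action_ker phi h.
Proof.
move=> kg /cycleP[n ->]; elim: n => [|n IHn]; first exact: action_ker1.
by rewrite expgS; exact: action_kerM.
Qed.

Lemma action_ker_neq1 phi :
  vertices (GAS gT X) phi -> exists2 g, action_ker phi g & g != 1%g.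
Proof.
move=> Vphi; apply: contrapT => no_g; apply: Vphi; apply/seteqP; split=> g /=.
  by move=> kg; apply/eqP; apply: contrapT => /negP g1; apply: no_g; exists g.
by move=> ->; exact: action_ker1.
Qed.

Lemma action_ker_setT_inj phi psi :
  action_ker phi = [set: gT]%classic -> action_ker psi = [set: gT]%classic ->
  phi = psi.
Proof.
move=> kphi kpsi.
have eq_act : (phi : X -> gT -> X) = psi.
  apply/funext => x; apply/funext => g.
  have /action_kerP-> : action_ker phi g by rewrite kphi.
  by have /action_kerP-> : action_ker psi g by rewrite kpsi.
case: phi psi eq_act {kphi kpsi} => f pf [f' pf'] /= eq_ff'.
by subst f'; congr Action; exact: Prop_irrelevance.
Qed.

Lemma exists_action_ker_setT :
  exists phi, action_ker phi = [set: gT]%classic.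
Proof.
have actP : is_action [set: gT]%g (fun (x : X) (_ : gT) => x) by split=> [g x y|].
exists (Action actP).
by apply/seteqP; split=> // g _; apply/action_kerP.
Qed.

Lemma GAS_complete phi psi :
  (exists! H : {group gT}, simple H) ->
  vertices (GAS gT X) phi -> vertices (GAS gT X) psi -> phi <> psi ->
  adj (GAS gT X) phi psi.
Proof.
case=> H [simH uniqH] Vphi Vpsi neq; split=> // kerI1.
(* A nontrivial [g] in the kernel generates a cyclic group, whose simple subgroup can only be
   [H]. *)
have sH theta h : vertices (GAS gT X) theta -> h \in H -> action_ker theta h.
  case/action_ker_neq1=> g kg g1 hH.
  have [K simK /fintype.subsetP sK] : exists2 K : {group gT}, simple K & K \subset <[g]>%g.
    by apply: exists_simple_subgroup; rewrite cycle_eq1.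
  by apply: (cycle_sub_action_ker kg); apply: sK; rewrite -(uniqH _ simK).
have /simpleP[/trivgPn[h hH /eqP h1] _] := simH; apply: h1.
have : (action_ker phi `&` action_ker psi)%classic h by split; exact: sH.
by rewrite kerI1.
Qed.

Lemma GAS_pendant_ker_inj phi psi :
  (exists! H : {group gT}, simple H) ->
  (exists theta, pendant_vertex (GAS gT X) theta) ->
  vertices (GAS gT X) phi -> vertices (GAS gT X) psi ->
  action_ker phi = action_ker psi -> phi = psi.
Proof.
move=> simple1 [p [Vp /card_set_bijP[f [f_fun f_inj _]]]] Vphi Vpsi eq_ker.
have Vp' theta : vertices (GAS gT X) theta -> theta <> p ->
    adj (GAS gT X) p theta.
  by move=> Vtheta /nesym; exact: GAS_complete.
(* [f] maps the neighbours of [p] injectively into [I_1], whose only element is 0. *)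
have nbr_uniq theta eta : adj (GAS gT X) p theta -> adj (GAS gT X) p eta ->
    theta = eta.
  move=> pt pe; apply: f_inj; rewrite ?in_setE //.
  by move: (f_fun _ pt) (f_fun _ pe); rewrite /= !ltnS !leqn0 => /eqP-> /eqP->.
have [tau ktau] := exists_action_ker_setT.
(* The group is nontrivial because it contains a simple subgroup. *)
have Vtau : vertices (GAS gT X) tau.
  case: simple1 => H [/simpleP[/trivgPn[h _ /eqP h1] _] _] /= ktau1.
  by apply: h1; have : action_ker tau h; [rewrite ktau | rewrite ktau1].
apply: contrapT => neq_phi_psi.
(* If [tau] were [phi] or [psi], both kernels would be the whole group and [phi = psi]. *)
have [eq_t|neq_t] : tau = phi \/ tau <> phi by exact: EM.
  by apply: neq_phi_psi; apply: action_ker_setT_inj; rewrite -?eq_ker -eq_t.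
have neq_t' : tau <> psi.
  by move=> eq_t; apply: neq_t; apply: action_ker_setT_inj; rewrite // eq_ker -eq_t.
(* Of the three distinct vertices [tau], [phi], [psi], two differ from [p] and are thus both its
   neighbour. *)
have [eq_p|neq_p] : phi = p \/ phi <> p by exact: EM.
  by apply: neq_t'; apply: nbr_uniq; apply: Vp'; rewrite -?eq_p //; exact: nesym.
have [eq_p|neq_p'] : psi = p \/ psi <> p by exact: EM.
  by apply: neq_t; apply: nbr_uniq; apply: Vp'; rewrite -?eq_p.
by apply: neq_phi_psi; apply: nbr_uniq; apply: Vp'.
Qed.

End Kernels.

Theorem theorem4p4 (gT : finGroupType) (X : Type)
  (solG : solvable [set: gT]%g)
  (connGAS : connected_graph (GAS gT X))
  (simple1 : exists! H : {group gT}, simple H)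
  (pendGAS : exists phi, pendant_vertex (GAS gT X) phi)
  (Gr : graph {action gT &-> X}) (gasGr : is_gas Gr) :
  Gr = GAS gT X.
Proof.
case: gasGr => Y [sYV repY] ->.
(* The representative of the kernel of [phi] can only be [phi] itself. *)
have sVY phi : vertices (GAS gT X) phi -> Y phi.
  move=> Vphi; have [psi [[Ypsi eq_ker] _]] := repY _ Vphi.
  by rewrite -(GAS_pendant_ker_inj simple1 pendGAS (sYV _ Ypsi) Vphi eq_ker).
apply: graph_ext => /=.
  by apply/seteqP; split=> phi; [case | move=> Vphi; split=> //; exact: sVY].
apply/funext => phi; apply/funext => psi; apply/propext; split=> [[]//|e].
by case: (e) => Vphi Vpsi _ _; split=> //; exact: sVY.
Qed.
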